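(* Let $q=mf+1$ be a power of a prime, with $m,f$ positive integers. Suppose $f-1=\lambda m$ with $\lambda$ a nonnegative integer, and let $\chi$ be a multiplicative character of order $m$ on $\mathbb{F}_q$. Then $H_{q,m}$ is a $(q,f,\lambda)$-difference set in $\mathbb{F}_q$ if and only if $$\sum_{t=1}^{m-1}J_q(\chi^s,\chi^t)=1,\quad s=1,\dots,m-1.$$
   Context: $H_{q,m}$ denotes the set of nonzero $m$th powers in $\mathbb{F}_q$. A subset $D\subseteq\mathbb{F}_q$ of size $k$ is a $(q,k,\lambda)$-difference set in $\mathbb{F}_q$ if for each nonzero $a\in\mathbb{F}_q$ there are exactly $\lambda$ ordered pairs $(x,y)\in D\times D$ with $x-y=a$. A multiplicative character on $\mathbb{F}_q$ is a homomorphism $\mathbb{F}_q^*\to\mathbb{C}^*$ extended to $0$ by the value $1$ if the character is trivial and $0$ if it is nontrivial. For $s\in\mathbb{Z}$, $\chi^s$ is the $s$th power of $\chi$ as a character of $\mathbb{F}_q^*$, extended to $0$ by this same rule. The Jacobi sum of multiplicative characters $\chi,\psi$ on $\mathbb{F}_q$ is $J_q(\chi,\psi)=\sum_{\alpha\in\mathbb{F}_q}\chi(\alpha)\psi(1-\alpha)$. *)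

(* Defs.v *)
From mathcomp Require Import all_boot all_order all_algebra.
From mathcomp Require Import complex reals.

Set Implicit Arguments.
Unset Strict Implicit.
Unset Printing Implicit Defensive.

Import GRing.Theory Num.Theory.
Local Open Scope ring_scope.

Definition power_residues (F : finFieldType) (m : nat) : {set F} :=
  [set y : F | (y != 0) && [exists x : F, y == x ^+ m]].

Definition difference_set (F : finFieldType) (q k lambda : nat) (D : {set F}) : Prop :=
  [/\ #|F| = q, #|D| = k &
      forall a : F, a != 0 ->
        #|[set xy in setX D D | xy.1 - xy.2 == a]| = lambda].

Definition trivial_on_units (F : finFieldType) (C : fieldType) (phi : F -> C) : bool :=
  [forall x : F, (x != 0) ==> (phi x == 1)].

(* Only the values of [phi] on nonzero elements matter: the value at 0 is
   replaced by 1 for the trivial character and by 0 for the others. *)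
Definition extend0 (F : finFieldType) (C : fieldType) (phi : F -> C) : F -> C :=
  fun x => if x == 0 then (if trivial_on_units phi then 1 else 0) else phi x.

Definition mult_character (F : finFieldType) (C : fieldType) (chi : F -> C) : Prop :=
  [/\ forall x : F, x != 0 -> chi x != 0,
      forall x y : F, x != 0 -> y != 0 -> chi (x * y) = chi x * chi y &
      chi 0 = extend0 chi 0].

Definition char_pow (F : finFieldType) (C : fieldType) (chi : F -> C) (s : int) : F -> C :=
  extend0 (fun x => chi x ^ s).

Definition char_order (F : finFieldType) (C : fieldType) (chi : F -> C) (m : nat) : Prop :=
  [/\ (0 < m)%N, trivial_on_units (char_pow chi m%:Z) &
      forall k : nat, (0 < k < m)%N -> ~~ trivial_on_units (char_pow chi k%:Z)].

Definition jacobi_sum (F : finFieldType) (C : fieldType) (chi psi : F -> C) : C :=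
  \sum_(a : F) chi a * psi (1 - a).

(* Main.v *)
Require Import Defs.
From mathcomp Require Import all_boot all_order all_algebra.
From mathcomp Require Import cyclic finfield.
From mathcomp Require Import complex reals.
Import GRing.Theory Num.Theory.
Local Open Scope ring_scope.

(** Write [H] for the group of nonzero [m]th powers, [N a] for the number of
    pairs in [H * H] with difference [a], and
    [S s] for the sum of [chi (1 - h) ^ s] over [h] in [H] other than [1].
    Both sides of the equivalence say that [S s = 0] for [0 < s < m], that is,
    that the [f - 1] values [chi (1 - h)] are equidistributed over the [m]th
    roots of unity.

    Since [chi] has order [m], its kernel on the cyclic group of units is
    exactly [H] ([mem_power_residues]), so [chi x ^ 0 + ... + chi x ^ (m - 1)]
    is [m] on [H] and [0] on the other units. Applied to [x = 1 - a], this
    gives [m * S s + 1] as the sum of the Jacobi sums for [s] ([sum_jacobi]),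
    which is [1] exactly when [S s = 0].

    On the other hand, dividing [x - y = a] by [x] shows that [N a] is the
    number of [h] in [H], [h <> 1], such that [1 - h] lies in the coset [a H]
    ([differences_ratio]). Hence [N] and [S] are Fourier transforms of each
    other: [f * S s] is the sum of [chi a ^ s * N a] over the units
    ([sum_char_differences]), and inversely [m * N a] is [f - 1] plus the sum
    of [chi a ^ (- t) * S t] for [0 < t < m] ([differences_char_expansion]).
    If [N] is constant, the former makes [S s] vanish by orthogonality; if
    every [S t] vanishes, the latter gives [m * N a = f - 1 = lambda * m]. *)

Set Implicit Arguments.
Unset Strict Implicit.

(** * Roots of unity and multiplicative characters *)

Lemma expf_card_pred (F : finFieldType) (x : F) : x != 0 -> x ^+ #|F|.-1 = 1.
Proof.
move=> x_neq0; apply: (mulfI x_neq0).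
by rewrite -exprS prednK ?expf_card ?mulr1 // ltnW // finNzRing_gt1.
Qed.

Lemma finField_prim_root (F : finFieldType) :
  exists z : F, (#|F|.-1).-primitive_root z.
Proof.
have F_gt1 := finNzRing_gt1 F.
have n_gt0 : (0 < #|F|.-1)%N by rewrite -subn1 subn_gt0.
have /hasP[z _ zP] : has (#|F|.-1).-primitive_root (enum (predC1 (0 : F))).
  apply: has_prim_root => //; last by rewrite -cardE cardC1.
    apply/allP => x; rewrite mem_enum inE => x_neq0; apply/unity_rootP.
    exact: expf_card_pred.
  exact: enum_uniq.
by exists z.
Qed.

Lemma sum_unity_root_powers (C : fieldType) (m : nat) (u : C) :
  u ^+ m = 1 -> \sum_(0 <= t < m) u ^+ t = m%:R *+ (u == 1).
Proof.
move=> um; rewrite big_mkord; case: eqVneq => [->|u_neq1].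
  by under eq_bigr do rewrite expr1n; rewrite sumr_const card_ord mulr1n.
rewrite mulr0n; apply: (@mulfI _ (u - 1)); first by rewrite subr_eq0.
by rewrite -subrX1 um subrr mulr0.
Qed.

Section Character.

Variables (F : finFieldType) (C : numFieldType) (chi : F -> C) (m : nat).
Hypotheses (chiP : mult_character chi) (chi_order : char_order chi m).

Let H : {set F} := power_residues F m.

Lemma mult_char_neq0 x : x != 0 -> chi x != 0.
Proof. by case: chiP => h _ _; apply: h. Qed.

Lemma mult_charM x y : x != 0 -> y != 0 -> chi (x * y) = chi x * chi y.
Proof. by case: chiP => _ h _; apply: h. Qed.

Lemma mult_char1 : chi 1 = 1.
Proof.
apply: (mulfI (mult_char_neq0 (oner_neq0 F))).
by rewrite -mult_charM ?oner_neq0 // !mulr1.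
Qed.

Lemma mult_charX x k : x != 0 -> chi (x ^+ k) = chi x ^+ k.
Proof.
move=> x_neq0; elim: k => [|k IHk]; first by rewrite !expr0 mult_char1.
by rewrite !exprS mult_charM ?IHk ?expf_neq0.
Qed.

Lemma mult_charV x : x != 0 -> chi x^-1 = (chi x)^-1.
Proof.
move=> x_neq0; apply: (mulfI (mult_char_neq0 x_neq0)).
by rewrite -mult_charM ?invr_eq0 // !divff ?mult_char1 ?mult_char_neq0.
Qed.

Lemma char_powE (s : nat) x : x != 0 -> char_pow chi s%:Z x = chi x ^+ s.
Proof. by move=> /negPf x_neq0; rewrite /char_pow /extend0 x_neq0. Qed.

Lemma trivial_char_powP (s : nat) :
  reflect (forall x, x != 0 -> chi x ^+ s = 1)
          (trivial_on_units (char_pow chi s%:Z)).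
Proof.
apply: (iffP forallP) => h x.
  by move=> x_neq0; have := h x; rewrite x_neq0 char_powE // => /eqP.
by apply/implyP => x_neq0; rewrite char_powE // h.
Qed.

Lemma mult_char_order_exp x : x != 0 -> chi x ^+ m = 1.
Proof. by case: chi_order => _ /trivial_char_powP h _; apply: h. Qed.

Lemma mult_char_nontrivial (s : nat) :
  (0 < s < m)%N -> exists2 x, x != 0 & chi x ^+ s != 1.
Proof.
case: chi_order => _ _ h /h /forallPn[x].
by rewrite negb_imply => /andP[x_neq0]; rewrite char_powE //; exists x.
Qed.

Lemma char_pow0 (s : nat) : (0 < s < m)%N -> char_pow chi s%:Z 0 = 0.
Proof.
move=> /mult_char_nontrivial[x x_neq0 x_neq1].
rewrite /char_pow /extend0 eqxx; case: ifP => // /forallP /(_ x).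
by rewrite x_neq0 /= (negPf x_neq1).
Qed.

(** Multiplying the summation variable by an element on which [chi ^ s] is
    not [1] multiplies the sum by that value, so the sum vanishes. *)
Lemma sum_mult_char (s : nat) :
  (0 < s < m)%N -> \sum_(x | x != 0) chi x ^+ s = 0.
Proof.
move=> /mult_char_nontrivial[g g_neq0 g_neq1].
apply: (@mulfI _ (chi g ^+ s - 1)); first by rewrite subr_eq0.
rewrite mulr0 mulrBl mul1r mulr_sumr; apply/eqP; rewrite subr_eq0; apply/eqP.
rewrite [RHS](reindex_inj (mulfI g_neq0)) /=.
apply: eq_big => x; first by rewrite mulf_eq0 (negPf g_neq0).
by move=> x_neq0; rewrite mult_charM // exprMn.
Qed.

(** If [z] generates the unit group, the order [m] of [chi] is that of the root
    of unity [chi z]; hence [chi (z ^+ i) = 1] forces [m] to divide [i], which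
    makes [z ^+ i] an [m]th power. *)
Lemma mem_power_residues x : x != 0 -> (x \in H) = (chi x == 1).
Proof.
move=> x_neq0; rewrite inE x_neq0 /=; apply/existsP/eqP => [[y /eqP xy]|chix1].
  have y_neq0 : y != 0.
    apply: contraNneq x_neq0 => y0; rewrite xy y0 expr0n.
    by case: chi_order => m_gt0 _ _; rewrite eqn0Ngt m_gt0.
  by rewrite xy mult_charX // mult_char_order_exp.
have [z zP] := finField_prim_root F.
have z_neq0 : z != 0.
  apply/eqP => z0; have /eqP := prim_expr_order zP.
  by rewrite z0 expr0n eqn0Ngt (prim_order_gt0 zP) eq_sym oner_eq0.
have zgen (y : F) : y != 0 -> exists i : nat, y = z ^+ i.
  by move=> /expf_card_pred /(prim_rootP zP)[i ->]; exists i.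
(* The order [k] of [chi z] divides [m], and [chi ^ k] is trivial because it is
   trivial on the generator, so [k] cannot be smaller than [m]. *)
have chizP : m.-primitive_root (chi z).
  have [m_gt0 _ _] := chi_order.
  have chizm : chi z ^+ m = 1 by apply: mult_char_order_exp.
  have [k kP k_dvd] := prim_order_exists m_gt0 chizm.
  suff -> : m = k by [].
  apply/eqP; rewrite eqn_leq [(k <= m)%N]dvdn_leq // andbT leqNgt.
  apply/negP => k_lt; have k_gt0 := prim_order_gt0 kP.
  have [|y y_neq0 /eqP[]] := @mult_char_nontrivial k; first by rewrite k_gt0.
  have [i ->] := zgen y y_neq0.
  by rewrite mult_charX // exprAC (prim_expr_order kP) expr1n.
have [i xz] := zgen x x_neq0.
have : chi z ^+ i = 1 by rewrite -mult_charX // -xz.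
move=> /eqP; rewrite -(prim_order_dvd chizP) => /dvdnP[j ij].
by exists (z ^+ j); rewrite xz ij exprM.
Qed.

Lemma power_residue_neq0 x : x \in H -> x != 0.
Proof. by rewrite inE => /andP[]. Qed.

Lemma power_residues1 : 1 \in H.
Proof. by rewrite mem_power_residues ?oner_neq0 // mult_char1. Qed.

Lemma power_residuesM x y : x \in H -> y \in H -> x * y \in H.
Proof.
move=> xH yH; have x0 := power_residue_neq0 xH.
have y0 := power_residue_neq0 yH; move: xH yH.
rewrite !mem_power_residues ?mulf_neq0 // mult_charM // => /eqP-> /eqP->.
by rewrite mulr1.
Qed.

Lemma power_residuesV x : x \in H -> x^-1 \in H.
Proof.
move=> xH; have x0 := power_residue_neq0 xH; move: xH.
rewrite !mem_power_residues ?invr_eq0 // mult_charV // => /eqP->.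
by rewrite invr1.
Qed.

Lemma sum_char_powers x :
  x != 0 -> \sum_(0 <= t < m) chi x ^+ t = m%:R *+ (x \in H) :> C.
Proof.
move=> x_neq0; rewrite sum_unity_root_powers ?mult_char_order_exp //.
by rewrite mem_power_residues.
Qed.

(** Double counting of the sum of [chi x ^+ t] over units [x] and [t < m]:
    summing over [t] first gives [m] for each [x] in [H], and summing over [x]
    first leaves only [t = 0], which counts the units. *)
Lemma card_power_residues : (m * #|H|)%N = #|F|.-1.
Proof.
apply/eqP; rewrite -(eqr_nat C) natrM; apply/eqP.
have [m_gt0 _ _] := chi_order.
transitivity (\sum_(x : F | x != 0) \sum_(0 <= t < m) chi x ^+ t).
  rewrite -sum1_card natr_sum mulr_sumr big_mkcond [RHS]big_mkcond.
  apply: eq_bigr => x _; case: eqVneq => [->|x_neq0] /=.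
    by rewrite ifF // inE eqxx.
  by rewrite sum_char_powers //; case: (x \in H); rewrite ?mulr1.
rewrite exchange_big /= big_ltn // big_nat [X in _ + X]big1 ?addr0 => [|t t_bd].
  under eq_bigr do rewrite expr0.
  by rewrite sumr_const cardC1.
exact: sum_mult_char.
Qed.

(** * Jacobi sums and differences of residues *)

Definition residue_shift_sum (s : nat) : C :=
  \sum_(h in H | h != 1) chi (1 - h) ^+ s.

(** Summing over [t] first turns the characters of [1 - a] into [m] times the
    indicator of [H], up to the missing term [t = 0]; that term contributes
    the sum of [chi ^ s] over [a != 1], which is [-1]. *)
Lemma sum_jacobi (s : nat) : (0 < s < m)%N ->
  \sum_(1 <= t < m) jacobi_sum (char_pow chi s%:Z) (char_pow chi t%:Z)
    = m%:R * residue_shift_sum s + 1.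
Proof.
move=> s_bd; have [m_gt0 _ _] := chi_order.
rewrite /jacobi_sum exchange_big /=.
(* The substitution [h = 1 - a] exchanges the roles of the two arguments:
   [a] is then the argument of [chi ^ s] and [1 - a] the element of [H]. *)
have -> : m%:R * residue_shift_sum s =
    \sum_(a : F | a != 1) m%:R *+ (1 - a \in H) * char_pow chi s%:Z a.
  rewrite /residue_shift_sum mulr_sumr.
  rewrite (reindex_inj (inv_inj (subKr (1 : F)))) /=.
  rewrite big_mkcond [RHS]big_mkcond; apply: eq_bigr => a _.
  rewrite subKr (can2_eq (subKr _) (subKr _)) subrr.
  case: (eqVneq a 1) => [->|a_neq1].
    by rewrite subrr ifF // inE eqxx.
  case: (eqVneq a 0) => [->|a_neq0]; rewrite ?andbF ?char_pow0 ?mulr0 //.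
  by rewrite andbT char_powE //; case: (_ \in H); rewrite ?mul0r.
(* The sum over the whole field vanishes, and the term [a = 1] is [1]. *)
have sum_neq1 : \sum_(a : F | a != 1) char_pow chi s%:Z a = -1.
  have: \sum_(a : F) char_pow chi s%:Z a = 0.
    rewrite (bigD1 0) //= char_pow0 // add0r -[RHS](sum_mult_char s_bd).
    by apply: eq_bigr => a /char_powE ->.
  rewrite (bigD1 1) //= char_powE ?oner_neq0 // mult_char1 expr1n => /eqP.
  by rewrite addr_eq0 => /eqP ->; rewrite opprK.
(* The term [a = 1] is split off: there [1 - a = 0], which all [chi ^ t] with
   [0 < t < m] send to [0]. *)
rewrite (bigD1 1) //= big_nat big1 ?add0r => [|t t_bd].
  rewrite -[X in _ + X]opprK -sum_neq1 -sumrB; apply: eq_bigr => a a_neq1.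
  rewrite -mulr_sumr mulrC -[X in _ = _ - X]mul1r -mulrBl; congr (_ * _).
  have b_neq0 : 1 - a != 0 by rewrite subr_eq0 eq_sym.
  rewrite -sum_char_powers // [in RHS]big_ltn // expr0 [RHS]addrC addKr.
  by apply: eq_big_nat => t _; rewrite char_powE.
by rewrite subrr char_pow0 ?mulr0.
Qed.

Definition differences (a : F) : nat :=
  #|[set xy in setX H H | xy.1 - xy.2 == a]|.

(** A difference [x - y = a] of elements of the group [H] is recorded by the
    ratio [h = y / x], for which [x = a / (1 - h)]. *)
Lemma differences_ratio (a : F) : a != 0 ->
  differences a = #|[set h in H | (h != 1) && ((1 - h) / a \in H)]|.
Proof.
move=> a_neq0.
rewrite /differences -(card_in_imset (f := fun xy : F * F => xy.2 / xy.1))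
  => [|[x y] [x' y']].
  apply: eq_card => h; rewrite [RHS]in_set; apply/imsetP/and3P.
    case=> -[x y]; rewrite in_set in_setX /= => /andP[/andP[xH yH] /eqP xya] ->.
    have x_neq0 := power_residue_neq0 xH.
    have xa : 1 - y / x = a / x by rewrite -xya mulrBl divff.
    split; first by rewrite power_residuesM // power_residuesV.
      by rewrite -subr_eq0 -oppr_eq0 opprB xa mulf_neq0 ?invr_eq0.
    by rewrite xa mulrAC divff // mul1r power_residuesV.
  case=> hH h_neq1 hH'.
  have h1_neq0 : 1 - h != 0 by rewrite subr_eq0 eq_sym.
  have xH : a / (1 - h) \in H by rewrite -invf_div power_residuesV.
  have x_neq0 := power_residue_neq0 xH.
  exists (a / (1 - h), h * (a / (1 - h))); last by rewrite /= mulfK.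
  rewrite in_set in_setX /= xH power_residuesM //=.
  by rewrite -[X in X - h * _]mul1r -mulrBl mulrC divfK.
rewrite in_set in_setX /= => /andP[/andP[xH yH] /eqP xya].
rewrite in_set in_setX /= => /andP[/andP[x'H y'H] /eqP xya'] yx.
have x0 := power_residue_neq0 xH; have x'0 := power_residue_neq0 x'H.
(* Dividing [x - y = a] by [x] gives [a / x = 1 - y / x], so the ratio
   determines [x]. *)
have xx' : x = x'.
  apply: invr_inj; apply: (mulfI a_neq0).
  by rewrite -{1}xya -xya' !mulrBl !divff // yx.
by move: yx; rewrite xx' => /(divIf x'0) ->.
Qed.

Lemma differences_sum (a : F) : a != 0 ->
  (differences a)%:R = \sum_(h in H | h != 1) ((1 - h) / a \in H)%:R :> C.
Proof.
move=> a_neq0; rewrite differences_ratio // -sum1_card natr_sum.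
rewrite big_mkcond [RHS]big_mkcond; apply: eq_bigr => h _.
by rewrite inE; case: (h \in H) => //=; case: (h != 1) => //=; case: (_ \in H).
Qed.

(** The involution exchanging [a] and [b / a] maps the coset [b H] onto [H],
    where [chi] is [1]. *)
Lemma sum_char_coset (s : nat) b : b != 0 ->
  \sum_(a | a != 0) chi a ^+ s * (b / a \in H)%:R = #|H|%:R * chi b ^+ s.
Proof.
move=> b_neq0.
have divK : involutive (fun a => b / a).
  by move=> a; rewrite invf_div mulrCA divff ?mulr1.
rewrite (reindex_inj (inv_inj divK)) /=.
rewrite -sum1_card natr_sum mulr_suml big_mkcond [RHS]big_mkcond.
apply: eq_bigr => x _; rewrite divK mulf_eq0 invr_eq0 (negPf b_neq0) /=.
case: (eqVneq x 0) => [->|x_neq0] /=; first by rewrite ifF // inE eqxx.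
case: (boolP (x \in H)) => [|_]; rewrite ?mulr0 //.
rewrite mem_power_residues // => /eqP x1.
by rewrite mult_charM ?invr_eq0 // mult_charV // x1 invr1 !mulr1 mul1r.
Qed.

(** Each [h] contributes to [N a] for [a] in a single coset of [H], on which
    [chi] is constantly [chi (1 - h)]. *)
Lemma sum_char_differences (s : nat) :
  \sum_(a | a != 0) chi a ^+ s * (differences a)%:R
    = #|H|%:R * residue_shift_sum s.
Proof.
under eq_bigr => a a_neq0 do rewrite differences_sum // mulr_sumr.
rewrite exchange_big /= /residue_shift_sum mulr_sumr; apply: eq_bigr => h.
by case/andP=> _ h_neq1; rewrite sum_char_coset // subr_eq0 eq_sym.
Qed.

(** Expanding the indicator of [(1 - h) / a] in [H] into powers of [chi]; the
    term [t = 0] counts the [h] other than [1]. *)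
Lemma differences_char_expansion (a : F) : a != 0 ->
  m%:R * (differences a)%:R
    = (#|H| - 1)%:R + \sum_(1 <= t < m) chi a ^- t * residue_shift_sum t.
Proof.
move=> a_neq0; have [m_gt0 _ _] := chi_order.
transitivity (\sum_(0 <= t < m) chi a ^- t * residue_shift_sum t).
  rewrite differences_sum // mulr_sumr /residue_shift_sum.
  under [RHS]eq_bigr do rewrite mulr_sumr.
  rewrite exchange_big /=; apply: eq_bigr => h /andP[_ h_neq1].
  have h_neq0 : 1 - h != 0 by rewrite subr_eq0 eq_sym.
  rewrite mulr_natr -sum_char_powers ?mulf_neq0 ?invr_eq0 //.
  apply: eq_bigr => t _.
  by rewrite mult_charM ?invr_eq0 // mult_charV // exprMn exprVn mulrC.
rewrite big_ltn // expr0 invr1 mul1r; congr (_ + _).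
rewrite /residue_shift_sum; under eq_bigr do rewrite expr0.
rewrite sumr_const (cardD1 1 H) power_residues1 addKn.
by apply/(congr1 (fun n => n%:R))/eq_card => h; rewrite inE andbC.
Qed.

End Character.

(** * Residue difference sets *)

Theorem theorem3p2 (R : realType) (F : finFieldType) (q m f lambda : nat)
    (hF : #|F| = q) (hq : q = (m * f + 1)%N) (hm : (0 < m)%N) (hf : (0 < f)%N)
    (hlambda : (f - 1 = lambda * m)%N)
    (chi : F -> complex R) (hchi : mult_character chi) (hord : char_order chi m) :
  difference_set q f lambda (power_residues F m) <->
  (forall s : nat, (1 <= s <= m - 1)%N ->
     \sum_(1 <= t < m) jacobi_sum (char_pow chi s%:Z) (char_pow chi t%:Z) = 1).
Proof.
have m_neq0 : (m%:R : complex R) != 0 by rewrite pnatr_eq0 -lt0n.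
have cardH : #|power_residues F m| = f.
  apply/eqP; rewrite -(eqn_pmul2l hm) (card_power_residues hchi hord).
  by rewrite hF hq addn1.
have bdE s : (1 <= s <= m - 1)%N = (0 < s < m)%N.
  by rewrite subn1 -[in RHS](prednK hm).
have jacobiE s : (0 < s < m)%N ->
    \sum_(1 <= t < m) jacobi_sum (char_pow chi s%:Z) (char_pow chi t%:Z) = 1 <->
    residue_shift_sum chi m s = 0.
  move=> s_bd; rewrite (sum_jacobi hchi hord) //; split=> [/eqP|->].
    by rewrite -subr_eq0 addrK mulf_eq0 (negPf m_neq0) => /eqP.
  by rewrite mulr0 add0r.
split=> [[_ _ diffE] s|sumE].
  rewrite bdE => s_bd; apply/(jacobiE s s_bd).
  have f_neq0 : (f%:R : complex R) != 0 by rewrite pnatr_eq0 -lt0n.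
  apply: (mulfI f_neq0); rewrite mulr0 -cardH -(sum_char_differences hchi hord).
  under eq_bigr => a a_neq0 do rewrite /differences diffE //.
  by rewrite -mulr_suml (sum_mult_char hchi hord) // mul0r.
split=> // a a_neq0; apply/eqP.
rewrite -(eqn_pmul2l hm) -(eqr_nat (complex R)) natrM.
rewrite (differences_char_expansion hchi hord) // big_nat big1 => [|t t_bd].
  by rewrite addr0 cardH hlambda mulnC.
have -> : residue_shift_sum chi m t = 0.
  by apply/(jacobiE t t_bd)/sumE; rewrite bdE.
by rewrite mulr0.
Qed.
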